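(* Let $\mathcal{T}_1,\mathcal{T}_2,\mathcal{T}$ be graph matrices (as described in the context), and for a positive integer $N$ and a square matrix $M$ define $$S(N,M)=\sum_{g\mid N}\mu(g)\,\mathrm{Tr}\,M^{N/g}.$$ Let $\mathcal{T}_1\otimes\mathcal{T}_2$ denote the Kronecker product of $\mathcal{T}_1$ and $\mathcal{T}_2$. Then for every positive integer $N$, $$\sum_{[s,t]=N} S(s,\mathcal{T}_1)\,S(t,\mathcal{T}_2)=S(N,\mathcal{T}_1\otimes\mathcal{T}_2),$$ where the summation is over the pairs of positive integers $(s,t)$ with $[s,t]=N$. Furthermore, for all positive integers $N$ and $l$, $$S(N,\mathcal{T}^{l})=\sum_{[l,t]=Nl}S(t,\mathcal{T}),$$ where the summation is over the positive integers $t$ with $[l,t]=Nl$.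
   Context: $[s,t]$ denotes the least common multiple of the positive integers $s$ and $t$; $\mu$ is the Möbius function; sums over $g\mid N$ run over the positive divisors of $N$. Graph matrices. The matrix $\mathcal{T}$ associated with a graph $G$ stands for any one of $T$, $A_d$, $T_d$ defined as follows. Graphs may have multiple edges and loops. (i) $G=(V,E)$ a finite connected undirected graph with no 1-degree vertices. Orient the edges $e_1,\dots,e_{|E|}$ arbitrarily and add the oppositely oriented edges $e_{|E|+i}=(e_i)^{-1}$, $1\le i\le |E|$ (for a loop $e_i$, $e_{|E|+i}$ is an additional oriented loop at the same vertex). The edge adjacency matrix $T$ is the $2|E|\times 2|E|$ matrix with $T_{ij}=1$ if the end vertex of $e_i$ is the start vertex of $e_j$ and $e_j$ is not the inverse edge of $e_i$, and $T_{ij}=0$ otherwise. (ii) $G=(V,E)$ a finite, strongly connected directed graph with no 1-degree vertices. The directed vertex adjacency matrix $A_d$ is the $|V|\times|V|$ matrix whose $(i,j)$ entry is the number of edges directed from vertex $i$ to vertex $j$. The directed edge adjacency matrix $T_d$ is the $|E|\times|E|$ matrix with $(T_d)_{ij}=1$ if the end vertex of edge $i$ is the start vertex of edge $j$, and $0$ otherwise. *)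

(* Defs.v *)
From mathcomp Require Import all_boot all_order all_algebra.
From mathcomp Require Export mxtens.

Set Implicit Arguments.
Unset Strict Implicit.
Unset Printing Implicit Defensive.

Import GRing.Theory.
Local Open Scope nat_scope.

(* Vertices and edges are numbered, as their numbers index the matrices below. *)

(* Undirected multigraph: a loop is an edge whose set of ends is a singleton. *)
Record ugraph := UGraph {
  uverts : nat;
  uedges : nat;
  uends : 'I_uedges -> {set 'I_uverts};
  uends_card : forall e, 0 < #|uends e| <= 2
}.

Definition uadj (G : ugraph) : rel 'I_(uverts G) :=
  fun x y => [exists e : 'I_(uedges G), uends e == [set x; y]].

Definition uconnected (G : ugraph) : Prop :=
  0 < uverts G /\ forall x y : 'I_(uverts G), connect (@uadj G) x y.

(* A loop contributes 2 to the degree of its vertex. *)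
Definition udegree (G : ugraph) (v : 'I_(uverts G)) : nat :=
  \sum_(e < uedges G | v \in uends e) (if #|uends e| == 1 then 2 else 1).

Record orientation (G : ugraph) := Orientation {
  ostart : 'I_(uedges G) -> 'I_(uverts G);
  oend : 'I_(uedges G) -> 'I_(uverts G);
  oendsP : forall e, uends e = [set ostart e; oend e]
}.

(* The oriented edges e_1, ..., e_2|E| are indexed by 'I_(|E| + |E|): lshift k
   is the edge k with its given orientation and rshift k is its inverse. *)
Definition arc_start (G : ugraph) (o : orientation G)
    (i : 'I_(uedges G + uedges G)) : 'I_(uverts G) :=
  match split i with inl k => ostart o k | inr k => oend o k end.

Definition arc_end (G : ugraph) (o : orientation G)
    (i : 'I_(uedges G + uedges G)) : 'I_(uverts G) :=
  match split i with inl k => oend o k | inr k => ostart o k end.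

Definition arc_inv (G : ugraph) (i : 'I_(uedges G + uedges G)) :
    'I_(uedges G + uedges G) :=
  match split i with inl k => rshift _ k | inr k => lshift _ k end.

Definition edge_adj_mx (G : ugraph) (o : orientation G) :
    'M[int]_(uedges G + uedges G) :=
  (\matrix_(i, j) ((arc_end o i == arc_start o j) && (j != arc_inv i))%:R)%R.

Record dgraph := DGraph {
  dverts : nat;
  dedges : nat;
  dstart : 'I_dedges -> 'I_dverts;
  dend : 'I_dedges -> 'I_dverts
}.

Definition dadj (G : dgraph) : rel 'I_(dverts G) :=
  fun x y => [exists e : 'I_(dedges G), (dstart e == x) && (dend e == y)].

Definition strongly_connected (G : dgraph) : Prop :=
  0 < dverts G /\ forall x y : 'I_(dverts G), connect (@dadj G) x y.

Definition ddegree (G : dgraph) (v : 'I_(dverts G)) : nat :=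
  #|[set e | dstart e == v]| + #|[set e | dend e == v]|.

Definition dvertex_adj_mx (G : dgraph) : 'M[int]_(dverts G) :=
  (\matrix_(i, j) #|[set e | (dstart e == i) && (dend e == j)]|%:R)%R.

Definition dedge_adj_mx (G : dgraph) : 'M[int]_(dedges G) :=
  (\matrix_(i, j) (dend i == dstart j)%:R)%R.

Variant graph_matrix : forall n : nat, 'M[int]_n -> Prop :=
| GraphMatrixT (G : ugraph) (o : orientation G) of
    uconnected G & (forall v : 'I_(uverts G), udegree v <> 1) :
    graph_matrix (edge_adj_mx o)
| GraphMatrixAd (G : dgraph) of
    strongly_connected G & (forall v : 'I_(dverts G), ddegree v <> 1) :
    graph_matrix (dvertex_adj_mx G)
| GraphMatrixTd (G : dgraph) of
    strongly_connected G & (forall v : 'I_(dverts G), ddegree v <> 1) :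
    graph_matrix (dedge_adj_mx G).

Definition squarefree (n : nat) : bool :=
  (0 < n) && all (fun p => ~~ (p ^ 2 %| n)) (primes n).

Definition mobius (n : nat) : int :=
  (if squarefree n then (-1) ^+ size (primes n) else 0)%R.

Definition traceS (N n : nat) (M : 'M[int]_n) : int :=
  (\sum_(g <- divisors N) mobius g * \tr (M ^+ (N %/ g)))%R.

(* Main.v *)
Require Import Defs.
From mathcomp Require Import all_boot all_order all_algebra.
From mathcomp Require Import mxtens.

(** The function [N |-> S(N, M)] is the Moebius transform of
    [N |-> tr (M ^+ N)], so by Moebius inversion the sum of [S(d, M)] over the
    divisors [d] of [N] is [tr (M ^+ N)] ([sum_traceS]).  A function on the
    positive integers is determined by its divisor sums ([sum_divisors_inj]),
    so both identities follow by comparing the divisor sums of the two sides.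

    Summing over the divisors [d] of [N] removes the constraint on the least
    common multiple.  In the first identity, the pairs [(s, t)] for which
    [lcmn s t] divides [N] are all the pairs of divisors of [N], so the sum
    factors as [tr (T1 ^+ N) * tr (T2 ^+ N)], which is the trace of
    [(T1 *t T2) ^+ N].  In the second identity, the [t] for which [lcmn l t] is
    [d * l] for some divisor [d] of [N] are all the divisors of [N * l], so the
    sum is [tr (T ^+ (N * l))], which is the trace of [(T ^+ l) ^+ N]. *)

Import GRing.Theory.
Local Open Scope ring_scope.

(** * Sums over divisors *)

(** The ranges of summation [1, ..., m] depend on [m]; this puts all of them,
    for the divisors [m] of [N], over the common range [divisors N], so that
    the order of summation can be exchanged. *)
Lemma sum_nat_divisors (m N : nat) (F : nat -> int) :
  (0 < N)%N -> (m %| N)%N -> (forall d, ~~ (d %| m)%N -> F d = 0) ->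
  \sum_(1 <= d < m.+1) F d = \sum_(d <- divisors N) F d.
Proof.
move=> N_gt0 mN F0; have m_gt0 := dvdn_gt0 N_gt0 mN.
apply: perm_big_supp; apply: uniq_perm; rewrite ?filter_uniq ?iota_uniq //.
  exact: divisors_uniq.
move=> d; rewrite !mem_filter mem_index_iota ltnS -dvdn_divisors //.
case: (boolP (d %| m)%N) => [dm | /F0->]; last by rewrite eqxx.
by rewrite (dvdn_gt0 m_gt0 dm) (dvdn_leq m_gt0 dm) (dvdn_trans dm mN).
Qed.

Lemma sum_nat_divisors_cond (m N : nat) (P : pred nat) (F : nat -> int) :
  (0 < N)%N -> (m %| N)%N -> (forall d, P d -> (d %| m)%N) ->
  \sum_(1 <= d < m.+1 | P d) F d = \sum_(d <- divisors N | P d) F d.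
Proof.
move=> N_gt0 mN Pm; rewrite big_mkcond [RHS]big_mkcond /=.
by apply: sum_nat_divisors => // d; case: ifP => // /Pm->.
Qed.

Lemma sum_divisors_multiples (e N : nat) (F : nat -> int) :
  (0 < N)%N -> (e %| N)%N ->
  \sum_(d <- divisors N | (e %| d)%N) F d
    = \sum_(g <- divisors (N %/ e)) F (g * e)%N.
Proof.
move=> N_gt0 eN; have e_gt0 := dvdn_gt0 N_gt0 eN.
have Ne_gt0 : (0 < N %/ e)%N by rewrite divn_gt0 // dvdn_leq.
rewrite -[RHS](big_map (muln^~ e) xpredT F) -[LHS]big_filter.
apply: perm_big; apply: uniq_perm.
- by rewrite filter_uniq ?divisors_uniq.
- rewrite map_inj_uniq ?divisors_uniq // => x y /eqP.
  by rewrite eqn_pmul2r // => /eqP.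
move=> d; rewrite mem_filter -dvdn_divisors //.
apply/andP/mapP => [[/dvdnP[g ->] gN] | [g]].
  by exists g; rewrite // -dvdn_divisors // dvdn_divRL.
by rewrite -dvdn_divisors // dvdn_divRL // => geN ->; rewrite dvdn_mull.
Qed.

Lemma divKn_dvd (d n : nat) : (0 < n)%N -> (d %| n)%N -> (n %/ (n %/ d) = d)%N.
Proof.
move=> n_gt0 dn; have d_gt0 := dvdn_gt0 n_gt0 dn.
have nd_gt0 : (0 < n %/ d)%N by rewrite divn_gt0 // dvdn_leq.
by apply/eqP; rewrite eq_sym eqn_div ?dvdn_div // mulnC divnK.
Qed.

Lemma sum_divisors_compl (N : nat) (F : nat -> int) :
  (0 < N)%N ->
  \sum_(d <- divisors N) F d = \sum_(d <- divisors N) F (N %/ d)%N.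
Proof.
move=> N_gt0; rewrite -[RHS](big_map (divn N) xpredT F).
have divNK d : d \in divisors N -> (N %/ (N %/ d) = d)%N.
  rewrite -dvdn_divisors // => dN; exact: divKn_dvd.
apply: perm_big; apply: uniq_perm.
- exact: divisors_uniq.
- by rewrite map_inj_in_uniq ?divisors_uniq //; apply: can_in_inj divNK.
move=> d; apply/idP/mapP => [dN | [e]].
  exists (N %/ d)%N; last by rewrite divNK.
  by move: dN; rewrite -!dvdn_divisors // => /dvdn_div.
by rewrite -!dvdn_divisors // => /dvdn_div dN ->.
Qed.

Lemma sum_divisors_pred1 (k N : nat) (F : nat -> int) :
  (0 < N)%N -> (k %| N)%N -> \sum_(d <- divisors N | d == k) F d = F k.
Proof.
move=> N_gt0 kN; rewrite big_mkcond (bigD1_seq k) ?divisors_uniq //=.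
  by rewrite eqxx big1 ?addr0 // => d /negPf->.
by rewrite -dvdn_divisors.
Qed.

Lemma sum_divisors_inj (a b : nat -> int) :
  (forall N, (0 < N)%N ->
     \sum_(d <- divisors N) a d = \sum_(d <- divisors N) b d) ->
  forall N, (0 < N)%N -> a N = b N.
Proof.
move=> ab N; have [m] := ubnP N; elim: m N => // m IHm N ltNm N_gt0.
have NN := divisors_id N_gt0; have uN := divisors_uniq N.
have := ab N N_gt0; rewrite (bigD1_seq N NN uN) [RHS](bigD1_seq N NN uN) /=.
suff -> : \sum_(d <- divisors N | d != N) a d
          = \sum_(d <- divisors N | d != N) b d by move/addIr.
rewrite big_seq_cond [RHS]big_seq_cond; apply: eq_bigr => d /andP[].
rewrite -dvdn_divisors // => dN ne_dN; apply: IHm (dvdn_gt0 N_gt0 dN).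
by rewrite (leq_trans _ (_ : N <= m)%N) // ltn_neqAle ne_dN dvdn_leq.
Qed.

(** * Moebius inversion *)

Lemma mobius_primeM_dvd (p n : nat) :
  prime p -> (0 < n)%N -> (p %| n)%N -> mobius (p * n) = 0.
Proof.
move=> p_pr n_gt0 pn; rewrite /mobius /squarefree.
case: ifP => // /andP[pn_gt0 /allP/(_ p)].
rewrite mem_primes p_pr pn_gt0 dvdn_mulr // => /(_ isT).
by rewrite expnS expn1 dvdn_pmul2l ?prime_gt0 // pn.
Qed.

Lemma mobius_primeM (p n : nat) :
  prime p -> (0 < n)%N -> ~~ (p %| n)%N -> mobius (p * n) = - mobius n.
Proof.
move=> p_pr n_gt0 pn; have p_gt0 := prime_gt0 p_pr.
have pn_gt0 : (0 < p * n)%N by rewrite muln_gt0 p_gt0.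
have perm_pn : perm_eq (primes (p * n)) (p :: primes n).
  apply: uniq_perm; rewrite /= ?primes_uniq ?mem_primes ?(negPf pn) ?andbF //.
  by move=> q; rewrite primesM // primes_prime // !inE.
have sqf_pn : squarefree (p * n) = squarefree n.
  rewrite /squarefree pn_gt0 n_gt0 (perm_all _ perm_pn) /=.
  rewrite expnS expn1 dvdn_pmul2l // pn /=.
  apply: eq_in_all => q; rewrite mem_primes => /and3P[q_pr _ qn].
  rewrite Gauss_dvdr // coprimeXl // prime_coprime // dvdn_prime2 //.
  by apply: contraNneq pn => <-.
rewrite /mobius sqf_pn (perm_size perm_pn) /= exprS mulN1r.
by case: ifP; rewrite ?oppr0.
Qed.

(** For a prime [p] dividing [n], the divisors [g] of [n] prime to [p] cancel
    against their multiples [g * p], and [mobius] vanishes on the divisors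
    that [p] divides more than once. *)
Lemma sum_mobius (n : nat) :
  (0 < n)%N -> \sum_(g <- divisors n) mobius g = (n == 1%N)%:R.
Proof.
move=> n_gt0; case: eqP => [-> | /eqP n_neq1].
  by rewrite big_cons big_nil.
have n_gt1 : (1 < n)%N by rewrite ltn_neqAle eq_sym n_neq1.
have [p_pr pn] := (pdiv_prime n_gt1, pdiv_dvd n); set p := pdiv n in p_pr pn.
have p_gt0 := prime_gt0 p_pr.
have np_gt0 : (0 < n %/ p)%N by rewrite divn_gt0 // dvdn_leq.
rewrite (bigID (dvdn p)) /= sum_divisors_multiples //.
rewrite (bigID (dvdn p)) /= big_seq_cond big1 => [|g /andP[]]; last first.
  rewrite -dvdn_divisors // => /(dvdn_gt0 np_gt0) g_gt0 pg.
  by rewrite mulnC mobius_primeM_dvd.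
rewrite add0r big_seq_cond (eq_bigr (fun g => - mobius g)) => [|g /andP[]].
  rewrite -big_seq_cond sumrN; apply/eqP; rewrite addrC subr_eq0; apply/eqP.
  rewrite -big_filter -[RHS]big_filter; apply: perm_big.
  apply: uniq_perm; rewrite ?filter_uniq ?divisors_uniq // => g.
  rewrite !mem_filter -!dvdn_divisors // dvdn_divRL //.
  case: (boolP (p %| g)%N) => //= pg.
  by rewrite Gauss_dvd ?pn ?andbT // coprime_sym prime_coprime.
rewrite -dvdn_divisors // => /(dvdn_gt0 np_gt0) g_gt0 pg.
by rewrite mulnC mobius_primeM.
Qed.

Lemma mobius_inversion (f : nat -> int) (N : nat) :
  (0 < N)%N ->
  \sum_(d <- divisors N) \sum_(g <- divisors d) mobius g * f (d %/ g)%N = f N.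
Proof.
move=> N_gt0.
(* Index the inner sum by e = d / g; the two sums can then be exchanged, and
   the coefficient of f e is the sum of mobius over the divisors of N / e. *)
have flip d : d \in divisors N ->
    \sum_(g <- divisors d) mobius g * f (d %/ g)%N
      = \sum_(e <- divisors N | (e %| d)%N) mobius (d %/ e)%N * f e.
  rewrite -dvdn_divisors // => dN; have d_gt0 := dvdn_gt0 N_gt0 dN.
  rewrite sum_divisors_compl // -[RHS]big_filter.
  rewrite big_seq (eq_bigr (fun e => mobius (d %/ e)%N * f e)) => [|e].
    rewrite -big_seq; apply: perm_big; apply: uniq_perm.
    - exact: divisors_uniq.
    - by rewrite filter_uniq ?divisors_uniq.
    move=> e; rewrite mem_filter -!dvdn_divisors //.
    by case: (boolP (e %| d)%N) => // /dvdn_trans->.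
  rewrite -dvdn_divisors // => ed; congr (_ * f _).
  by rewrite divKn_dvd.
rewrite big_seq (eq_bigr _ flip) -big_seq (exchange_big_dep xpredT) //=.
rewrite (bigD1_seq N) ?divisors_uniq ?divisors_id //=.
have inner e : e \in divisors N ->
    \sum_(d <- divisors N | (e %| d)%N) mobius (d %/ e)%N * f e
      = (N %/ e == 1)%N%:R * f e.
  rewrite -dvdn_divisors // => eN; have e_gt0 := dvdn_gt0 N_gt0 eN.
  rewrite -mulr_suml sum_divisors_multiples // -sum_mobius.
    by congr (_ * _); apply: eq_bigr => g _; rewrite mulnK.
  by rewrite divn_gt0 // dvdn_leq.
rewrite inner ?divisors_id // divnn N_gt0 mul1r big_seq_cond big1 ?addr0 //.
move=> e /andP[eN ne_eN]; rewrite inner //; move: eN; rewrite -dvdn_divisors //.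
move=> eN; rewrite -eqn_mul ?(dvdn_gt0 N_gt0 eN) //.
by rewrite mul1n eq_sym (negPf ne_eN) mul0r.
Qed.

(** * Traces of powers *)

Lemma sum_traceS (n N : nat) (M : 'M[int]_n) :
  (0 < N)%N -> \sum_(d <- divisors N) traceS d M = \tr (M ^+ N).
Proof. exact: (mobius_inversion (fun k => \tr (M ^+ k))). Qed.

Lemma tensmx1 (R : pzRingType) (m n : nat) :
  (1%:M : 'M[R]_m) *t (1%:M : 'M[R]_n) = 1%:M.
Proof.
apply/matrixP=> i j.
case: (mxtens_indexP i) => i1 i2; case: (mxtens_indexP j) => j1 j2.
rewrite tensmxE !mxE (can_eq (@mxtens_indexK m n)) xpair_eqE.
by case: eqP; rewrite ?mul0r ?mul1r.
Qed.

Lemma tensmxX (R : comPzRingType) (m n k : nat) (A : 'M[R]_m) (B : 'M[R]_n) :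
  (A *t B) ^+ k = (A ^+ k) *t (B ^+ k).
Proof.
elim: k => [|k IHk]; first by rewrite !expr0 tensmx1.
by rewrite !exprS IHk -!mulmxE tensmx_mul.
Qed.

Lemma mxtrace_tens (R : pzRingType) (m n : nat) (A : 'M[R]_m) (B : 'M[R]_n) :
  \tr (A *t B) = \tr A * \tr B.
Proof. by rewrite /mxtrace mulr_sum; apply: eq_bigr => i _; rewrite mxE. Qed.

Lemma sum_lcmn_traceS (n1 n2 N : nat) (A : 'M[int]_n1) (B : 'M[int]_n2) :
  (0 < N)%N ->
  \sum_(1 <= s < N.+1) \sum_(1 <= t < N.+1 | lcmn s t == N)
     traceS s A * traceS t B
  = traceS N (A *t B).
Proof.
move: N; apply: sum_divisors_inj => N N_gt0.
(* Both sides become a double sum over the divisors s and t of N, once each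
   pair (s, t) is counted only for the divisor d = lcmn s t. *)
rewrite sum_traceS // tensmxX mxtrace_tens -!sum_traceS //.
have common d : d \in divisors N ->
    \sum_(1 <= s < d.+1) \sum_(1 <= t < d.+1 | lcmn s t == d)
       traceS s A * traceS t B
    = \sum_(s <- divisors N) \sum_(t <- divisors N | lcmn s t == d)
       traceS s A * traceS t B.
  rewrite -dvdn_divisors // => dN; rewrite (sum_nat_divisors _ N) // => [|s sd].
    apply: eq_bigr => s _; apply: sum_nat_divisors_cond => // t /eqP <-.
    exact: dvdn_lcmr.
  by rewrite big1 // => t /eqP lcm_d; rewrite -lcm_d dvdn_lcml in sd.
rewrite big_seq (eq_bigr _ common) -big_seq exchange_big mulr_suml /=.
apply: eq_big_seq => s; rewrite -dvdn_divisors // => sN.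
rewrite (exchange_big_dep xpredT) //= mulr_sumr; apply: eq_big_seq => t.
rewrite -dvdn_divisors // => tN.
rewrite (eq_bigl (pred1 (lcmn s t))) => [|d]; last by rewrite /= eq_sym.
by rewrite sum_divisors_pred1 // dvdn_lcm sN.
Qed.

Lemma traceS_exp (n l N : nat) (M : 'M[int]_n) :
  (0 < l)%N -> (0 < N)%N ->
  traceS N (M ^+ l)
  = \sum_(1 <= t < (N * l).+1 | lcmn l t == (N * l)%N) traceS t M.
Proof.
move=> l_gt0; move: N; apply: sum_divisors_inj => N N_gt0.
have Nl_gt0 : (0 < N * l)%N by rewrite muln_gt0 N_gt0.
rewrite sum_traceS // -exprM mulnC -sum_traceS //.
have common d : d \in divisors N ->
    \sum_(1 <= t < (d * l).+1 | lcmn l t == (d * l)%N) traceS t M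
    = \sum_(t <- divisors (N * l) | lcmn l t == (d * l)%N) traceS t M.
  rewrite -dvdn_divisors // => dN; apply: sum_nat_divisors_cond => //.
    by rewrite dvdn_pmul2r.
  by move=> t /eqP <-; apply: dvdn_lcmr.
rewrite [RHS]big_seq (eq_bigr _ common) -big_seq.
rewrite (exchange_big_dep xpredT) //=; apply: eq_big_seq => t.
rewrite -dvdn_divisors // => tNl.
rewrite (eq_bigl (pred1 (lcmn l t %/ l)%N)) => [|d]; last first.
  by rewrite /= eq_sym -eqn_div ?dvdn_lcml // eq_sym.
rewrite sum_divisors_pred1 // dvdn_divLR ?dvdn_lcml //.
by rewrite dvdn_lcm tNl dvdn_mull.
Qed.

Theorem theorem2p2 (n1 n2 n : nat)
    (T1 : 'M[int]_n1) (T2 : 'M[int]_n2) (T : 'M[int]_n)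
    (hT1 : graph_matrix T1) (hT2 : graph_matrix T2) (hT : graph_matrix T) :
  (forall N : nat, (0 < N)%N ->
     \sum_(1 <= s < N.+1) \sum_(1 <= t < N.+1 | lcmn s t == N)
        traceS s T1 * traceS t T2
     = traceS N (T1 *t T2)) /\
  (forall N l : nat, (0 < N)%N -> (0 < l)%N ->
     traceS N (T ^+ l)
     = \sum_(1 <= t < (N * l).+1 | lcmn l t == (N * l)%N) traceS t T).
Proof.
split=> [N N_gt0 | N l N_gt0 l_gt0]; first exact: sum_lcmn_traceS.
exact: traceS_exp.
Qed.
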